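(* Let $\mathcal{E}$ be a category with pull-backs, let $A$ and $X$ be objects of $\mathcal{E}$, and let $U \subseteq_X A$ and $U' \subseteq_X A$ be generalized subobjects of $A$ at stage $X$. Then $U \subseteq_X U'$ if and only if for every arrow $\alpha : Y \to X$ in $\mathcal{E}$ and every generalized element $a \in_Y A$, $a \in_Y \alpha^*(U)$ implies $a \in_Y \alpha^*(U')$.
   Context: $\mathcal{E}$ is a category with pull-backs (no terminal object or binary products are assumed). Generalized elements: $a \in_Y A$ means that $a : Y \to A$ is an arrow of $\mathcal{E}$ (''a generalized element of $A$ at stage $Y$''). Generalized subobjects: a generalized subobject $U$ of $A$ at stage $X$, written $U \subseteq_X A$, is an equivalence class of jointly monic spans $A \xleftarrow{c} M \xrightarrow{d} X$, where $(c,d)$ and $(c',d')$ (with middle objects $M$, $M'$) are equivalent if there is an isomorphism $\mu : M \to M'$ with $c' \circ \mu = c$ and $d' \circ \mu = d$. Partial order: if $U, U' \subseteq_X A$ are represented by $(c,d)$ and $(c',d')$ respectively, then $U \subseteq_X U'$ means that there is a (necessarily unique) $\mu : M \to M'$ with $c' \circ \mu = c$ and $d' \circ \mu = d$. Change of stage: for $U \subseteq_X A$ represented by $(c,d)$ and $\alpha : Y \to X$, form a pull-back of $d$ along $\alpha$, with projections $m : P \to M$ and $d' : P \to Y$; then $\alpha^*(U) \subseteq_Y A$ is the generalized subobject represented by the (jointly monic) span $(c \circ m, d')$. It does not depend on the choices. Membership: for $V \subseteq_Y A$ represented by $A \xleftarrow{c} N \xrightarrow{d} Y$ and $a \in_Y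 A$, $a \in_Y V$ means that there is a (necessarily unique) $a_0 : Y \to N$ with $c \circ a_0 = a$ and $d \circ a_0 = \mathrm{id}_Y$. *)

(* Defs.v *)
From Stdlib Require Import Setoid.

Set Implicit Arguments.
Unset Strict Implicit.

Declare Scope cat_scope.
Delimit Scope cat_scope with cat.
Open Scope cat_scope.

Record Category := {
  Ob :> Type;
  Hom : Ob -> Ob -> Type;
  idm : forall A, Hom A A;
  comp : forall A B C, Hom B C -> Hom A B -> Hom A C;
  comp_idl : forall A B (f : Hom A B), comp (idm B) f = f;
  comp_idr : forall A B (f : Hom A B), comp f (idm A) = f;
  comp_assoc : forall A B C D (h : Hom C D) (g : Hom B C) (f : Hom A B),
    comp h (comp g f) = comp (comp h g) f
}.
Arguments Hom {_} _ _.
Arguments idm {_} _.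
Arguments comp {_ _ _ _} _ _.

Notation "g \o f" := (comp g f) (at level 40, left associativity) : cat_scope.

Definition is_iso (E : Category) (A B : E) (f : Hom A B) : Prop :=
  exists g : Hom B A, g \o f = idm A /\ f \o g = idm B.

Definition is_pullback (E : Category) (B C D P : E)
    (f : Hom B D) (g : Hom C D) (p : Hom P B) (q : Hom P C) : Prop :=
  f \o p = g \o q /\
  forall (Z : E) (u : Hom Z B) (v : Hom Z C), f \o u = g \o v ->
    exists! w : Hom Z P, p \o w = u /\ q \o w = v.

(* Mere existence: no choice of pull-backs is part of the data. *)
Definition has_pullbacks (E : Category) : Prop :=
  forall (B C D : E) (f : Hom B D) (g : Hom C D),
    exists (P : E) (p : Hom P B) (q : Hom P C), is_pullback f g p q.

Definition jointly_monic (E : Category) (A X M : E)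
    (c : Hom M A) (d : Hom M X) : Prop :=
  forall (Z : E) (u v : Hom Z M), c \o u = c \o v -> d \o u = d \o v -> u = v.

Record jmspan (E : Category) (A X : E) := {
  apex : E;
  lleg : Hom apex A;
  rleg : Hom apex X;
  jmspanP : jointly_monic lleg rleg
}.

Definition span_map (E : Category) (A X : E) (s t : jmspan A X)
    (mu : Hom (apex s) (apex t)) : Prop :=
  lleg t \o mu = lleg s /\ rleg t \o mu = rleg s.

Definition span_equiv (E : Category) (A X : E) (s t : jmspan A X) : Prop :=
  exists mu : Hom (apex s) (apex t), is_iso mu /\ span_map mu.

Definition span_le (E : Category) (A X : E) (s t : jmspan A X) : Prop :=
  exists mu : Hom (apex s) (apex t), span_map mu.

(* An equivalence class is given by its membership predicate:
   [represents U s] says that the span s belongs to the class U. *)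
Record gensub (E : Category) (A X : E) := {
  represents : jmspan A X -> Prop;
  gensubP : exists s, forall t, represents t <-> span_equiv s t
}.

Definition gensub_le (E : Category) (A X : E) (U U' : gensub A X) : Prop :=
  exists s s' : jmspan A X,
    represents U s /\ represents U' s' /\ span_le s s'.

Definition gensub_mem (E : Category) (A Y : E)
    (a : Hom Y A) (V : gensub A Y) : Prop :=
  exists s : jmspan A Y, represents V s /\
    exists a0 : Hom Y (apex s), lleg s \o a0 = a /\ rleg s \o a0 = idm Y.

Lemma span_le_trans (E : Category) (A X : E) (r s t : jmspan A X) :
  span_le r s -> span_le s t -> span_le r t.
Proof.
intros [mu [Hl Hr]] [nu [Kl Kr]]; exists (nu \o mu).
split; rewrite comp_assoc; [rewrite Kl | rewrite Kr]; assumption.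
Qed.

Lemma span_equivE (E : Category) (A X : E) (s t : jmspan A X) :
  span_equiv s t <-> span_le s t /\ span_le t s.
Proof.
split.
- intros [mu [[nu [K1 K2]] [Hl Hr]]]; split; [now exists mu; split |].
  exists nu; split; [rewrite <- Hl | rewrite <- Hr];
    now rewrite <- comp_assoc, K2, comp_idr.
- intros [[mu [Hl Hr]] [nu [Kl Kr]]]; exists mu; split; [| now split].
  exists nu; split; apply jmspanP; rewrite comp_assoc, comp_idr;
    congruence.
Qed.

Lemma span_equiv_sym (E : Category) (A X : E) (s t : jmspan A X) :
  span_equiv s t -> span_equiv t s.
Proof. rewrite !span_equivE; tauto. Qed.

Lemma span_equiv_trans (E : Category) (A X : E) (r s t : jmspan A X) :
  span_equiv r s -> span_equiv s t -> span_equiv r t.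
Proof.
rewrite !span_equivE; intros [H1 H2] [K1 K2].
split; eapply span_le_trans; eassumption.
Qed.

Lemma span_equiv_refl (E : Category) (A X : E) (s : jmspan A X) :
  span_equiv s s.
Proof.
apply span_equivE; split; exists (idm _); split; apply comp_idr.
Qed.

Lemma represents_equiv (E : Category) (A X : E) (U : gensub A X)
    (s t : jmspan A X) :
  represents U s -> represents U t -> span_equiv s t.
Proof.
destruct (gensubP U) as [r Hr]; rewrite !Hr; intros Hs Ht.
exact (span_equiv_trans (span_equiv_sym Hs) Ht).
Qed.

Lemma gensub_leE (E : Category) (A X : E) (U U' : gensub A X)
    (s s' : jmspan A X) :
  represents U s -> represents U' s' -> gensub_le U U' <-> span_le s s'.
Proof.
intros Hs Hs'; split; [| now intros H; exists s, s'].
intros [t [t' [Ht [Ht' H]]]].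
destruct (proj1 (span_equivE _ _) (represents_equiv Hs Ht)) as [H1 _].
destruct (proj1 (span_equivE _ _) (represents_equiv Ht' Hs')) as [H2 _].
exact (span_le_trans H1 (span_le_trans H H2)).
Qed.

Lemma gensub_memE (E : Category) (A Y : E) (a : Hom Y A) (V : gensub A Y)
    (s : jmspan A Y) :
  represents V s ->
  gensub_mem a V <->
  exists a0 : Hom Y (apex s), lleg s \o a0 = a /\ rleg s \o a0 = idm Y.
Proof.
intros Hs; split; [| now intros H; exists s].
intros [t [Ht [a0 [H1 H2]]]].
destruct (represents_equiv Ht Hs) as [mu [_ [Kl Kr]]].
exists (mu \o a0); rewrite !comp_assoc, Kl, Kr; now split.
Qed.

Lemma pullback_jointly_monic (E : Category) (A X Y P : E)
    (s : jmspan A X) (alpha : Hom Y X)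
    (m : Hom P (apex s)) (d' : Hom P Y) :
  is_pullback (rleg s) alpha m d' -> jointly_monic (lleg s \o m) d'.
Proof.
intros [sq univ] Z u v Hc Hd.
assert (Hm : m \o u = m \o v).
{ apply jmspanP; rewrite !comp_assoc; [exact Hc |].
  rewrite sq, <- !comp_assoc; congruence. }
destruct (univ Z (m \o v) (d' \o v)) as [w [_ Hw]].
{ rewrite !comp_assoc; congruence. }
rewrite <- (Hw u), <- (Hw v); now split.
Qed.

Definition pullback_span (E : Category) (A X Y P : E)
    (s : jmspan A X) (alpha : Hom Y X)
    (m : Hom P (apex s)) (d' : Hom P Y)
    (H : is_pullback (rleg s) alpha m d') : jmspan A Y :=
  Build_jmspan (pullback_jointly_monic H).

Lemma pullback_span_le (E : Category) (A X Y P Q : E)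
    (s t : jmspan A X) (alpha : Hom Y X)
    (m : Hom P (apex s)) (d : Hom P Y) (n : Hom Q (apex t)) (e : Hom Q Y)
    (Hs : is_pullback (rleg s) alpha m d)
    (Ht : is_pullback (rleg t) alpha n e) :
  span_le s t -> span_le (pullback_span Hs) (pullback_span Ht).
Proof.
intros [mu [Hl Hr]].
destruct (proj2 Ht P (mu \o m) d) as [w [[Hn He] _]].
{ rewrite comp_assoc, Hr; exact (proj1 Hs). }
exists w; split; simpl; [| exact He].
rewrite <- comp_assoc, Hn, comp_assoc, Hl; reflexivity.
Qed.

(* The class alpha^*(U): all spans equivalent to (c \o m, d') for some
   representative (c, d) of U and some pull-back (m, d') of d along alpha. *)
Definition change_stage_rep (E : Category) (A X Y : E)
    (alpha : Hom Y X) (U : gensub A X) (t : jmspan A Y) : Prop :=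
  exists s : jmspan A X, represents U s /\
  exists (P : E) (m : Hom P (apex s)) (d' : Hom P Y)
    (H : is_pullback (rleg s) alpha m d'),
    span_equiv (pullback_span H) t.

Lemma change_stageP (E : Category) (HE : has_pullbacks E) (A X Y : E)
    (alpha : Hom Y X) (U : gensub A X) :
  exists s, forall t, change_stage_rep alpha U t <-> span_equiv s t.
Proof.
destruct (gensubP U) as [s Hs].
assert (Us : represents U s) by (apply Hs, span_equiv_refl).
destruct (HE _ _ _ (rleg s) alpha) as [P [m [d' H]]].
exists (pullback_span H); intros t; split.
- intros [s' [Us' [P' [m' [d'' [H' Ht]]]]]].
  apply span_equiv_trans with (2 := Ht), span_equivE.
  destruct (proj1 (span_equivE _ _) (represents_equiv Us Us')) as [H1 H2].
  now split; apply pullback_span_le.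
- intros Ht; exists s; split; [exact Us | now exists P, m, d', H].
Qed.

Definition change_stage (E : Category) (HE : has_pullbacks E) (A X Y : E)
    (alpha : Hom Y X) (U : gensub A X) : gensub A Y :=
  Build_gensub (change_stageP HE alpha U).

(* Main.v *)
Require Import Defs.

(** Let [s = (c, d)] represent [U].  By the universal property of the pull-back
    of [d] along [alpha], a section of its projection to [Y] is the same thing
    as a lift of [alpha] through [d]; hence [a] belongs to [alpha^*(U)] exactly
    when the span [(a, alpha)] factors through [(c, d)]
    ([mem_change_stageE]).  The proposition is thus the Yoneda lemma for spans:
    factorizations through [s] compose with a map of spans [s -> s'], and
    conversely the generic element [c], taken at the stage [d], factors through
    [s] by the identity, so that its factorization through [s'] is a map of
    spans [s -> s']. *)

Lemma gensub_represented (E : Category) (A X : E) (U : gensub A X) :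
  exists s, represents U s.
Proof.
destruct (gensubP U) as [s Hs].
exists s; apply Hs, span_equiv_refl.
Qed.

(** Eliminates the change of stage: pull-backs no longer occur on the
    right-hand side, which only speaks of arrows into a representative. *)
Lemma mem_change_stageE (E : Category) (HE : has_pullbacks E) (A X Y : E)
    (U : gensub A X) (s : jmspan A X) (alpha : Hom Y X) (a : Hom Y A) :
  represents U s ->
  gensub_mem a (change_stage HE alpha U) <->
  exists b : Hom Y (apex s), lleg s \o b = a /\ rleg s \o b = alpha.
Proof.
intros Us.
destruct (HE _ _ _ (rleg s) alpha) as [P [m [d' H]]].
assert (Hrep : represents (change_stage HE alpha U) (pullback_span H)).
{ exists s; split; [exact Us |].
  exists P, m, d', H; apply span_equiv_refl. }
rewrite (gensub_memE a Hrep); simpl; destruct H as [sq univ]; simpl.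
split.
- intros [a0 [Ha Hid]]; exists (m \o a0); split.
  + now rewrite comp_assoc.
  + now rewrite comp_assoc, sq, <- comp_assoc, Hid, comp_idr.
- intros [b [Ha Hb]].
  destruct (univ Y b (idm Y)) as [a0 [[Hm Hid] _]].
  { now rewrite comp_idr. }
  exists a0; split; [| exact Hid].
  now rewrite <- comp_assoc, Hm.
Qed.

Theorem proposition2p1 (E : Category) (HE : has_pullbacks E) (A X : E)
    (U U' : gensub A X) :
  gensub_le U U' <->
  forall (Y : E) (alpha : Hom Y X) (a : Hom Y A),
    gensub_mem a (change_stage HE alpha U) ->
    gensub_mem a (change_stage HE alpha U').
Proof.
destruct (gensub_represented E A X U) as [s Us].
destruct (gensub_represented E A X U') as [s' Us'].
rewrite (gensub_leE Us Us'); split.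
- intros [mu [Hl Hr]] Y alpha a.
  rewrite (mem_change_stageE E HE A X Y U s alpha a Us),
    (mem_change_stageE E HE A X Y U' s' alpha a Us').
  intros [b [Ha Hb]]; exists (mu \o b).
  now rewrite !comp_assoc, Hl, Hr.
- intros Hmem.
  (* The generic element: the left leg of [s], at the stage [rleg s]. *)
  apply (mem_change_stageE E HE A X _ U' s' (rleg s) (lleg s) Us'), Hmem.
  apply (mem_change_stageE E HE A X _ U s (rleg s) (lleg s) Us).
  exists (idm _); split; apply comp_idr.
Qed.
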